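(* Let $n\in\mathbb{N}$. Define $$H_n([0,\infty)) := \big\{f:[0,\infty)\to\mathbb{C} \,\big|\, f^{(j)}\in AC_{loc}([0,\infty)),\ j=0,\dots,n-1;\ f^{(n)}\in L^2((0,\infty));\ f^{(j)}(0)=0,\ j=0,\dots,n-1\big\}$$ and $$\widehat H_n((0,\infty)) := \big\{f:(0,\infty)\to\mathbb{C} \,\big|\, f^{(j)}\in AC_{loc}((0,\infty)),\ j=0,\dots,n-1;\ f^{(n)},\ f/x^{n}\in L^2((0,\infty))\big\}.$$ Then $H_n([0,\infty))=\widehat H_n((0,\infty))$ as sets, in the following sense: if $f\in H_n([0,\infty))$ then its restriction to $(0,\infty)$ lies in $\widehat H_n((0,\infty))$; and if $f\in\widehat H_n((0,\infty))$, then the limits $f^{(j)}(0_+)=\lim_{x\downarrow0}f^{(j)}(x)$, $j=0,\dots,n-1$, exist and are finite, and the extension of $f$ to $[0,\infty)$ by $f(0):=f(0_+)$ belongs to $H_n([0,\infty))$.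
   Context: $AC_{loc}([0,\infty))$ denotes functions absolutely continuous on $[0,c]$ for every $c>0$; $AC_{loc}((0,\infty))$ denotes functions absolutely continuous on every compact subinterval of $(0,\infty)$. *)

(* Defs.v *)
From HB Require Import structures.
From mathcomp Require Import all_boot all_order all_algebra.
From mathcomp Require Import all_classical all_reals all_analysis.
Set Implicit Arguments. Unset Strict Implicit. Unset Printing Implicit Defensive.
Import Order.TTheory GRing.Theory Num.Theory.
Import numFieldNormedType.Exports.
Local Open Scope classical_set_scope.
Local Open Scope ring_scope.

(* A complex-valued function of a real variable is represented by its real
   and imaginary parts (u, v), i.e. f = u + i v. *)

Definition Ipos (R : realType) : set R := `]0, +oo[%classic.

Definition cmod (R : realType) (x y : R) : R := Num.sqrt (x ^+ 2 + y ^+ 2).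

Definition AC_on (R : realType) (a b : R) (u v : R -> R) : Prop :=
  forall e : R, 0 < e -> exists2 d : R, 0 < d &
    forall (m : nat) (s t : 'I_m -> R),
      (forall i, a <= s i /\ s i <= t i /\ t i <= b) ->
      (forall i j, i != j -> t i <= s j \/ t j <= s i) ->
      \sum_(i < m) (t i - s i) < d ->
      \sum_(i < m) cmod (u (t i) - u (s i)) (v (t i) - v (s i)) < e.

Definition ACloc0 (R : realType) (u v : R -> R) : Prop :=
  forall c : R, 0 < c -> AC_on 0 c u v.

Definition AClocpos (R : realType) (u v : R -> R) : Prop :=
  forall a b : R, 0 < a -> a <= b -> AC_on a b u v.

Definition L2pos (R : realType) (u v : R -> R) : Prop :=
  [/\ measurable_fun (@Ipos R) u, measurable_fun (@Ipos R) v &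
      (@lebesgue_measure R).-integrable (@Ipos R)
         (fun x => ((u x) ^+ 2 + (v x) ^+ 2)%:E)].

Definition ae_deriv (R : realType) (u v u' v' : R -> R) : Prop :=
  {ae (@lebesgue_measure R), forall x, Ipos x ->
     is_derive x (1 : R) u (u' x) /\ is_derive x (1 : R) v (v' x)}.

(* f = u + i v belongs to H_n([0,oo)); (U j, V j) is f^(j).
   Only the values on [0,oo) matter. *)
Definition in_H (R : realType) (n : nat) (u v : R -> R) : Prop :=
  exists U V : nat -> R -> R,
    [/\ forall x : R, 0 <= x -> U 0%N x = u x /\ V 0%N x = v x,
        forall j, (j < n)%N -> ACloc0 (U j) (V j),
        forall j, (j < n)%N -> ae_deriv (U j) (V j) (U j.+1) (V j.+1),
        L2pos (U n) (V n) &
        forall j, (j < n)%N -> U j 0 = 0 /\ V j 0 = 0].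

(* (U, V) witnesses that f = u + i v belongs to hat H_n((0,oo)).
   Only the values on (0,oo) matter. *)
Definition hatH_wit (R : realType) (n : nat) (u v : R -> R)
    (U V : nat -> R -> R) : Prop :=
  [/\ forall x : R, 0 < x -> U 0%N x = u x /\ V 0%N x = v x,
      forall j, (j < n)%N -> AClocpos (U j) (V j),
      forall j, (j < n)%N -> ae_deriv (U j) (V j) (U j.+1) (V j.+1),
      L2pos (U n) (V n) &
      L2pos (fun x => u x / x ^+ n) (fun x => v x / x ^+ n)].

Definition in_hatH (R : realType) (n : nat) (u v : R -> R) : Prop :=
  exists U V : nat -> R -> R, hatH_wit n u v U V.

(* Main.v *)
Require Import Defs.
From HB Require Import structures.
From mathcomp Require Import all_boot all_order all_algebra.
From mathcomp Require Import all_classical all_reals all_analysis.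
From mathcomp Require Import measurable_realfun ring lra.
Import Order.TTheory GRing.Theory Num.Theory.
Import numFieldNormedType.Exports.
Local Open Scope classical_set_scope.
Local Open Scope ring_scope.

(* Everything reduces to real-valued f, and rests on one fact: an absolutely
   continuous function with a.e. nonnegative derivative is nondecreasing.
   Compared with the primitive of an integrable majorant h of f', it gives
   f(b) - f(a) <= int_a^b h.
   If f is in H_n, a qualitative Hardy inequality (f(0) = 0 and f' / x^k in L^2
   imply f / x^(k+1) in L^2), iterated from f^(n) down to f, shows that f / x^n
   is in L^2. Conversely, f^(n) is integrable near 0, so
   all f^(j), j < n, extend absolutely continuously to 0. If j were the least
   index with f^(j)(0) <> 0, then |f| >= c x^j near 0, hence
   |f / x^n| >= c / x, which is not square integrable. *)

(** * Absolute continuity of real-valued functions on an interval *)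

Section AbsoluteContinuity.
Set Implicit Arguments.
Unset Strict Implicit.
Variable R : realType.
Notation mu := (@lebesgue_measure R).
Implicit Types (a b c : R) (f g h u v : R -> R) (U V : nat -> R -> R).

(** Real-valued counterpart of [AC_on], so that real and imaginary parts can be treated
    separately. *)
Definition ac a b f : Prop :=
  forall e : R, 0 < e -> exists2 d : R, 0 < d &
    forall (m : nat) (s t : 'I_m -> R),
      (forall i, a <= s i /\ s i <= t i /\ t i <= b) ->
      (forall i j, i != j -> t i <= s j \/ t j <= s i) ->
      \sum_(i < m) (t i - s i) < d ->
      \sum_(i < m) `|f (t i) - f (s i)| < e.

Lemma cmod_ge_l (x y : R) : `|x| <= cmod x y.
Proof. by rewrite /cmod -sqrtr_sqr ler_wsqrtr// lerDl sqr_ge0. Qed.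

Lemma cmod_ge_r (x y : R) : `|y| <= cmod x y.
Proof. by rewrite /cmod -sqrtr_sqr ler_wsqrtr// lerDr sqr_ge0. Qed.

Lemma cmod_le (x y : R) : cmod x y <= `|x| + `|y|.
Proof.
rewrite -(ger0_norm (addr_ge0 (normr_ge0 x) (normr_ge0 y))) -sqrtr_sqr.
apply: ler_wsqrtr; rewrite sqrrD !real_normK ?num_real//.
by rewrite addrAC lerDl mulrn_wge0// mulr_ge0.
Qed.

(** Common source of the closure properties below: a bound on increments passes to sums of
    increments. Two dominating functions accommodate sums and products; a single one is used
    twice. *)
Lemma ac_dom a b f g h (M : R) : ac a b f -> ac a b g ->
  (forall x y, a <= x -> x <= y -> y <= b ->
     `|h y - h x| <= M * (`|f y - f x| + `|g y - g x|)) -> ac a b h.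
Proof.
move=> acf acg hM e e0.
(* [M] may be zero or negative; [K] is a positive constant above it, by which one can divide. *)
pose K := `|M| + 1; have K0 : 0 < K by rewrite ltr_wpDl.
have e2 : 0 < e / (2 * K) by rewrite divr_gt0// mulr_gt0.
have [df df0 Hf] := acf _ e2; have [dg dg0 Hg] := acg _ e2.
exists (Num.min df dg); first by rewrite lt_min df0.
move=> m s t st dj; rewrite lt_min => /andP[sf sg].
apply: (@le_lt_trans _ _ (K * (\sum_(i < m) `|f (t i) - f (s i)|
                             + \sum_(i < m) `|g (t i) - g (s i)|))).
  rewrite -big_split mulr_sumr; apply: ler_sum => i _ /=.
  have [? [? ?]] := st i; apply: (le_trans (hM _ _ _ _ _)) => //.
  by apply: ler_wpM2r => //; rewrite /K (le_trans (ler_norm M))// lerDl.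
have := ltrD (Hf _ _ _ st dj sf) (Hg _ _ _ st dj sg).
rewrite -(ltr_pM2l K0) => /lt_le_trans; apply.
by rewrite le_eqVlt; apply/orP; left; apply/eqP; field; lra.
Qed.

Lemma AC_onP a b u v : AC_on a b u v <-> ac a b u /\ ac a b v.
Proof.
split=> [acuv|[acu acv] e e0].
  split=> e /acuv[d d0 H]; exists d => // m s t st dj sd;
    apply: le_lt_trans (H _ _ _ st dj sd); apply: ler_sum => i _.
  - exact: cmod_ge_l.
  - exact: cmod_ge_r.
have e2 : 0 < e / 2 by rewrite divr_gt0.
have [du du0 Hu] := acu _ e2; have [dv dv0 Hv] := acv _ e2.
exists (Num.min du dv); first by rewrite lt_min du0.
move=> m s t st dj; rewrite lt_min => /andP[su sv].
rewrite (splitr e).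
apply: le_lt_trans (ltrD (Hu _ _ _ st dj su) (Hv _ _ _ st dj sv)).
by rewrite -big_split; apply: ler_sum => i _; exact: cmod_le.
Qed.

Lemma ac_sub a b a' b' f : a <= a' -> b' <= b -> ac a b f -> ac a' b' f.
Proof.
move=> aa bb acf e /acf[d d0 H]; exists d => // m s t st; apply: H => i.
by have [? [? ?]] := st i; split; [exact: le_trans aa _|split => //; exact: le_trans bb].
Qed.

Lemma ac_eq a b f g : (forall x, a <= x -> x <= b -> f x = g x) ->
  ac a b f -> ac a b g.
Proof.
move=> fg acf; apply: (@ac_dom _ _ f f _ 1) => // x y ax xy yb.
rewrite mul1r -!fg ?lerDl//.
- exact: le_trans yb.
- exact: le_trans ax xy.
Qed.

Lemma ac_id a b : ac a b id.
Proof.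
move=> e e0; exists e => // m s t st _; apply: le_lt_trans.
by apply: ler_sum => i _; rewrite ger0_norm// subr_ge0; have [_ []] := st i.
Qed.

Lemma ac_lipschitz a b f (M : R) :
  (forall x y, a <= x -> x <= y -> y <= b -> `|f y - f x| <= M * `|y - x|) ->
  ac a b f.
Proof.
move=> fM; have acid := ac_id a b.
apply: (@ac_dom _ _ id id f `|M|) => // x y ax xy yb.
apply: (le_trans (fM _ _ ax xy yb)); apply: (@le_trans _ _ (`|M| * `|y - x|)).
  by apply: ler_wpM2r => //; exact: ler_norm.
by apply: ler_wpM2l => //; rewrite lerDl.
Qed.

(** Only empty increments remain. This allows statements about [ac 0 c] for every [c], without a
    sign condition. *)
Lemma ac_degenerate a b f : b <= a -> ac a b f.
Proof.
move=> ba; apply: (@ac_lipschitz _ _ _ 0) => x y ax xy yb.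
have -> : x = y.
  by apply/eqP; rewrite eq_le xy (le_trans yb)// (le_trans ba).
by rewrite subrr normr0 mul0r.
Qed.

Lemma ac_cst a b c : ac a b (fun=> c).
Proof. by apply: (@ac_lipschitz _ _ _ 0) => *; rewrite subrr normr0 mul0r. Qed.

Lemma acN a b f : ac a b f -> ac a b (fun x => - f x).
Proof.
move=> acf; apply: (@ac_dom _ _ f f _ 1) => // x y _ _ _.
by rewrite mul1r -opprD normrN lerDl.
Qed.

Lemma acD a b f g : ac a b f -> ac a b g -> ac a b (fun x => f x + g x).
Proof.
move=> acf acg; apply: (@ac_dom _ _ f g _ 1) => // x y _ _ _.
by rewrite mul1r opprD addrACA ler_normD.
Qed.

Lemma acB a b f g : ac a b f -> ac a b g -> ac a b (fun x => f x - g x).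
Proof. by move=> acf /acN; exact: acD. Qed.

(** The case of a single interval, [m = 1], in the definition. *)
Lemma ac_unif_cont a b f : ac a b f -> forall e, 0 < e ->
  exists2 d, 0 < d & forall x y, a <= x -> x <= b -> a <= y -> y <= b ->
    `|y - x| < d -> `|f y - f x| < e.
Proof.
move=> acf e /acf[d d0 H]; exists d => //.
have W x y : a <= x -> y <= b -> x <= y -> `|y - x| < d -> `|f y - f x| < e.
  move=> ax yb xy yxd.
  have := H 1%N (fun=> x) (fun=> y); rewrite !big_ord1; apply => //.
  - by move=> i j; rewrite !ord1.
  - by rewrite -(ger0_norm (_ : 0 <= y - x)) ?subr_ge0.
move=> x y ax xb ay yb yxd; have [xy|/ltW yx] := leP x y; first exact: W.
by rewrite distrC; apply: W => //; rewrite distrC.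
Qed.

Lemma ac_within_continuous a b f : ac a b f -> {within `[a, b], continuous f}.
Proof.
move=> acf; apply/subspace_continuousP => x /=; rewrite in_itv/= => /andP[ax xb].
apply/cvgrPdist_lt => e e0; have [d d0 H] := ac_unif_cont acf e0.
apply/nbhs_ballP; exists d => //= y; rewrite /ball/= in_itv/= => xyd /andP[ay yb].
by rewrite distrC; apply: H => //; rewrite distrC.
Qed.

Lemma ac_norm a b f : ac a b f -> ac a b (fun x => `|f x|).
Proof.
move=> acf; apply: (@ac_dom _ _ f f _ 1) => // x y _ _ _.
by rewrite mul1r (le_trans (ler_dist_dist _ _))// lerDl.
Qed.

Lemma ac_bounded a b f : ac a b f ->
  exists M, forall x, a <= x -> x <= b -> `|f x| <= M.
Proof.
move=> /ac_norm/ac_within_continuous cf; have [ab|ba] := leP a b; last first.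
  exists 0 => x ax xb; have := le_lt_trans (le_trans ax xb) ba.
  by rewrite ltxx.
have [c _ fc] := EVT_max ab cf.
by exists `|f c| => x ax xb; apply: fc; rewrite in_itv/= ax.
Qed.

(** Both factors are continuous on a compact interval, hence bounded, so an increment of the product
    is controlled by those of the factors. *)
Lemma acM a b f g : ac a b f -> ac a b g -> ac a b (fun x => f x * g x).
Proof.
move=> acf acg; have [Mf Hf] := ac_bounded acf; have [Mg Hg] := ac_bounded acg.
apply: (@ac_dom _ _ f g _ (`|Mf| + `|Mg|)) => // x y ax xy yb.
have -> : f y * g y - f x * g x = (f y - f x) * g y + f x * (g y - g x) by ring.
rewrite (le_trans (ler_normD _ _))// !normrM.
have fx := Hf _ ax (le_trans xy yb); have gy := Hg _ (le_trans ax xy) yb.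
have := ler_norm Mf; have := ler_norm Mg.
have := normr_ge0 (f y - f x); have := normr_ge0 (g y - g x).
have := normr_ge0 Mf; have := normr_ge0 Mg.
nra.
Qed.

Lemma acX a b f n : ac a b f -> ac a b (fun x => f x ^+ n).
Proof.
move=> acf; elim: n => [|n IH]; first exact: ac_cst.
by apply: ac_eq (acM acf IH) => x _ _; rewrite exprS.
Qed.

Lemma ac_inv a b : 0 < a -> ac a b (fun x => x^-1).
Proof.
move=> a0; apply: (@ac_lipschitz _ _ _ (a^-1 * a^-1)) => x y ax xy yb.
have x0 : 0 < x := lt_le_trans a0 ax; have y0 : 0 < y := lt_le_trans x0 xy.
have -> : y^-1 - x^-1 = - (y - x) * (x^-1 * y^-1) by field; rewrite !gt_eqF.
have xa : x^-1 <= a^-1 by rewrite lef_pV2.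
have ya : y^-1 <= a^-1 by rewrite lef_pV2 // (le_trans ax).
rewrite normrM normrN mulrC ler_wpM2r//.
rewrite ger0_norm ?mulr_ge0 ?invr_ge0 ?(ltW x0) ?(ltW y0)//.
by rewrite ler_pM// invr_ge0 ltW.
Qed.

Lemma ac_continuous_at a b f x : ac a b f -> a < x -> x < b -> {for x, continuous f}.
Proof.
move=> acf ax xb; apply/cvgrPdist_lt => e e0.
have [d d0 H] := ac_unif_cont acf e0; near=> y; rewrite distrC.
have /andP[ay yb] : a < y < b.
  by apply/andP; split; near: y; [exact: lt_nbhsr|exact: lt_nbhsl].
apply: H; rewrite ?ltW// distrC; near: y.
Unshelve. all: by end_near. Qed.

Lemma ac_integrable a b f : ac a b f ->
  (@lebesgue_measure R).-integrable `]a, b] (EFin \o f).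
Proof.
move=> /ac_within_continuous cf.
have := continuous_compact_integrable (@segment_compact _ a b) cf.
by apply: integrableS => //; exact: subset_itv_oc_cc.
Qed.

End AbsoluteContinuity.

(** * Monotonicity from the sign of the derivative *)

Section Monotonicity.
Set Implicit Arguments.
Unset Strict Implicit.
Variable R : realType.
Notation mu := (@lebesgue_measure R).
Implicit Types (a b c : R) (f g h u v : R -> R) (U V : nat -> R -> R).

Lemma lebesgue_measure_le (A B : set R) : measurable A -> measurable B ->
  A `<=` B -> (mu A <= mu B)%E.
Proof.
by move=> mA mB AB; apply: le_measure; rewrite ?inE; [exact: mA|exact: mB|].
Qed.

(* Straddle lemma: the estimate holds for all intervals around x, not only
   those with endpoint x, as the supremum argument below requires. *)
Lemma is_derive_ge0_straddle f (x d e : R) : is_derive x (1 : R) f d -> 0 <= d ->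
  0 < e -> exists2 r, 0 < r & forall y z, x - r < y -> y <= x -> x <= z ->
    z < x + r -> f y - f z <= e * (z - y).
Proof.
move=> [/= + fd] d0 e0; move: fd; rewrite /derive => fd /cvg_ex[l fl].
move: fd; rewrite (cvg_lim _ fl)// => ld; rewrite {}ld in fl.
move/cvgrPdist_lt : fl => /(_ _ e0); rewrite near_withinE => /nbhs_ballP[r /= r0 H].
have K k : `|k| < r -> k != 0 -> - e < k^-1 * (f (k + x) - f x).
  move=> kr k0; have := H k; rewrite /ball/= sub0r normrN => /(_ kr k0).
  rewrite [k *: _]mulr1 ltr_norml => /andP[_].
  by rewrite /GRing.scale/=; lra.
have Kr z : x <= z -> z < x + r -> f x - f z <= e * (z - x).
  rewrite le_eqVlt => /predU1P[->|xz zr]; first by rewrite !subrr mulr0.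
  have h0 : 0 < z - x by rewrite subr_gt0.
  have := K (z - x); rewrite gt_eqF// gtr0_norm// subrK ltrBlDl => /(_ zr isT).
  by rewrite mulrC ltr_pdivlMr// mulNr; lra.
have Kl y : x - r < y -> y <= x -> f y - f x <= e * (x - y).
  move=> xy; rewrite le_eqVlt => /predU1P[->|yx]; first by rewrite !subrr mulr0.
  have h0 : y - x < 0 by rewrite subr_lt0.
  have := K (y - x); rewrite lt_eqF// ltr0_norm// subrK opprB.
  have -> : x - y < r by lra.
  by move=> /(_ isT isT); rewrite mulrC ltr_ndivlMr// mulNr; lra.
exists r => // y z xy yx xz zx.
have := Kr _ xz zx; have := Kl _ xy yx; lra.
Qed.

(* The supremum of the x for which [a, x] splits into intervals on which f
   decreases at rate at most e and disjoint intervals contained in U is b; the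
   latter have total length < d, so f varies by less than e on them. *)
Lemma ac_derive_ge0_approx a b f (U : set R) (e d : R) : a <= b ->
  0 < e -> open U -> (mu U < d%:E)%E ->
  (forall m (s t : 'I_m -> R),
      (forall i, a <= s i /\ s i <= t i /\ t i <= b) ->
      (forall i j, i != j -> t i <= s j \/ t j <= s i) ->
      \sum_(i < m) (t i - s i) < d ->
      \sum_(i < m) `|f (t i) - f (s i)| < e) ->
  (forall x, a <= x <= b -> ~ U x ->
     exists2 d, is_derive x (1 : R) f d & 0 <= d) ->
  f a - f b <= e * (b - a) + e.
Proof.
move=> ab e0 oU Ud acf dU.
have mU : measurable (U : set R) by exact: open_measurable.
have mUI (i : interval R) : measurable (U `&` [set` i] : set R) by exact: measurableI.
(* The list [l] holds the intervals charged to [U], rightmost first because new ones are consed. The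
   half-open [[a, x[] keeps the next interval []x, z[] disjoint from the measure already spent. *)
pose P x := a <= x <= b /\ exists l : seq (R * R),
  [/\ all (fun p => [&& a <= p.1, p.1 <= p.2 & p.2 <= x]) l,
      pairwise (fun p q => q.2 <= p.1) l,
      ((\sum_(p <- l) (p.2 - p.1))%:E <= mu (U `&` `[a, x[))%E &
      f a - f x <= e * (x - a) + \sum_(p <- l) `|f p.2 - f p.1| ].
suff : P b.
  (* The list is read as a finite family; its total length is at most [mu U < d], so the hypothesis
     bounds the variation on it by [e]. *)
  move=> [_ [l [la lp ls lf]]]; apply: (le_trans lf); rewrite lerD2l.
  have /= := acf (size l) (fun i => (nth (0, 0) l i).1) (fun i => (nth (0, 0) l i).2).
  rewrite -(big_mkord xpredT (fun i => `|f (nth (0, 0) l i).2 - f (nth (0, 0) l i).1|)).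
  rewrite -(big_mkord xpredT (fun i => (nth (0, 0) l i).2 - (nth (0, 0) l i).1)).
  rewrite -(big_nth (0, 0) xpredT (fun p => p.2 - p.1)).
  rewrite -(big_nth (0, 0) xpredT (fun p => `|f p.2 - f p.1|)).
  move=> H; apply/ltW/H.
  - by move=> i; have /and3P[] := all_nthP (0, 0) la i (ltn_ord i).
  - move=> i j; rewrite neq_ltn => /orP[ij|ji]; [right|left];
      by apply: (pairwiseP (0, 0) lp); rewrite ?inE.
  - rewrite -lte_fin; apply: le_lt_trans ls _; apply: le_lt_trans Ud.
    exact: lebesgue_measure_le.
have Pa : P a.
  split; first by rewrite lexx.
  by exists [::]; split => //; rewrite ?big_nil// !subrr mulr0 add0r.
(* Passing from [y] to [z] either costs [e * (z - y)] and keeps [l], or adds [(y, z)] to [l], its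
   length being paid for by the part []y, z[] of [U]. *)
have step y z : P y -> y <= z -> z <= b ->
    f y - f z <= e * (z - y) \/ `]y, z[ `<=` U -> P z.
  move=> [/andP[ay yb] [l [la lp ls lf]]] yz zb.
  have la' : all (fun p => [&& a <= p.1, p.1 <= p.2 & p.2 <= z]) l.
    by apply: sub_all la => p /and3P[-> -> /le_trans]; exact.
  case=> [yzf|yzU]; split; rewrite ?(le_trans ay yz)//.
    exists l; split => //.
      apply: (le_trans ls); apply: lebesgue_measure_le => //.
      by apply: setIS; exact: subset_itvl.
    by lra.
  have muyz : ((z - y)%:E <= mu `]y, z[)%E.
    rewrite lebesgue_measure_itv/= lte_fin.
    by case: ltP => // zy; rewrite lee_fin subr_le0.
  exists ((y, z) :: l); split => //.
  - by rewrite /= ay yz lexx.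
  - by rewrite /= lp andbT; apply: sub_all la => p /and3P[].
  - rewrite big_cons/= EFinD.
    apply: (@le_trans _ _ (mu ((U `&` `[a, y[) `|` `]y, z[))%E).
      rewrite [leRHS]measureU; [|exact: mUI|exact: measurable_itv|]; last first.
        apply/seteqP; split => // x [[_]] /=; rewrite !in_itv/=.
        by move=> /andP[_ xy] /andP[/(lt_trans xy)]; rewrite ltxx.
      by rewrite addeC; exact: leeD.
    apply: lebesgue_measure_le => //; first exact: measurableU.
    move=> x [[Ux]|yxz]/=; rewrite ?in_itv/=.
      by move=> /andP[ax xy]; split => //; rewrite ?in_itv/= ax (lt_le_trans xy).
    split; first exact: yzU.
    by move: yxz; rewrite /= !in_itv/= => /andP[/ltW/(le_trans ay)-> ->].
  - rewrite big_cons/=; have := ler_norm (f y - f z).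
    rewrite (distrC (f z)).
    have : 0 <= e * (z - y) by rewrite mulr_ge0 ?subr_ge0// ltW.
    by lra.
pose S := [set x | P x].
have Sb : ubound S b by move=> x [/andP[]].
have supS : has_sup S by split; [exists a|exists b].
set c := sup S.
have ac : a <= c by apply: ub_le_sup => //; exists b.
have cb : c <= b by apply: ge_sup => //; exists a.
(* Around the supremum [c] one of the two kinds of step is available: openness of [U] if [c] lies in
   it, the straddle estimate otherwise. *)
have [r r0 gauge] : exists2 r, 0 < r & forall y z, c - r < y -> y <= c -> c <= z ->
    z < c + r -> f y - f z <= e * (z - y) \/ `]y, z[ `<=` U.
  have [Uc|nUc] := pselect (U c).
    have /nbhs_ballP[r /= r0 rU] := open_nbhs_nbhs (conj oU Uc).
    exists r => // y z cry yc cz zcr; right => x/=; rewrite in_itv/= => /andP[yx xz].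
    by apply: rU; rewrite /ball/= ltr_norml; lra.
  have [d' fd' d'0] := dU _ (introT andP (conj ac cb)) nUc.
  have [r r0 H] := is_derive_ge0_straddle fd' d'0 e0.
  by exists r => // y z *; left; exact: H.
have [y Py cry] := sup_adherent r0 supS.
have yc : y <= c by apply: ub_le_sup => //; exists b.
(* A step from some [y] of [S] near [c] across [c], stopped at [b]. As [P z] forces [z <= c], the
   stop must have occurred, so [z = b]. *)
pose z := Num.min b (c + r / 2).
have cz : c <= z by rewrite /z le_min cb lerDl divr_ge0// ltW.
have Pz : P z.
  apply: step Py _ _ _ => //.
  - exact: le_trans cz.
  - by rewrite /z ge_min lexx.
  - by apply: gauge => //; rewrite /z gt_min; apply/orP; right; lra.
have zc : z <= c by apply: ub_le_sup => //; exists b.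
suff <- : z = b by [].
apply/min_idPl; rewrite leNgt; apply/negP => brc.
by move: zc; rewrite /z (min_idPr (ltW brc)); lra.
Qed.

(** The exceptional null set is enclosed in an open set shorter than the [d] that absolute
    continuity assigns to [e]; the preceding estimate applies, and [e] tends to 0. *)
Lemma ac_derive_ge0 a b f : a <= b -> ac a b f ->
  {ae mu, forall x, a < x < b -> exists2 d, is_derive x (1 : R) f d & 0 <= d} ->
  f a <= f b.
Proof.
move=> ab acf [A [mA A0 AP]].
suff H e : 0 < e -> f a - f b <= e * (b - a) + e.
  apply/ler_addgt0Pr => e e0; pose K := b - a + 1.
  have K0 : 0 < K by rewrite /K; lra.
  have := H _ (divr_gt0 e0 K0).
  have -> : e / K * (b - a) + e / K = e by rewrite /K; field; rewrite /K in K0; lra.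
  by lra.
move=> e0; have [d d0 H] := acf _ e0.
(* The endpoints join the exceptional set, since the derivative is only controlled on the open
   interval. *)
pose D := A `|` ([set a] `|` [set b]).
have mD : measurable D by do 2 apply: measurableU => //.
have D0 : mu D = 0%E.
  have n1 (x : R) : mu.-negligible [set x].
    by exists [set x]; split => //; exact: lebesgue_measure_set1.
  apply/negligibleP => //; apply: negligibleU.
    by exists A; split; [exact: mA|exact: A0|].
  by apply: negligibleU; exact: n1.
have [|U [oU DU UD]] := lebesgue_regularity_outer mD _ d0.
  by rewrite [X in (X < _)%E]D0.
apply: (@ac_derive_ge0_approx _ _ _ U _ d) => //.
  (* Outer regularity bounds the measure of the difference of [U] and [D]; as [D] is null, the bound
     holds for [U]. *)
  have <- : D `|` (U `\` D) = U by rewrite setDUK.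
  apply: le_lt_trans UD; apply: (le_trans (measureU2 _ _ _)) => //.
    by apply: measurableD => //; exact: open_measurable.
  by rewrite [X in (X + _)%E]D0 add0e.
move=> x /andP[ax xb] nUx; have nDx : ~ D x by move=> /DU.
have xa : x != a by apply/eqP => xa; apply: nDx; right; left.
have xb' : x != b by apply/eqP => xb'; apply: nDx; right; right.
apply: contrapT => nd; apply: nDx; left; apply: AP => /= K; apply: nd; apply: K.
by rewrite !lt_neqAle eq_sym xa ax xb' xb.
Qed.

End Monotonicity.

(** * Primitives of integrable functions and integral bounds on increments *)

Section Integrals.
Set Implicit Arguments.
Unset Strict Implicit.
Variable R : realType.
Notation mu := (@lebesgue_measure R).
Implicit Types (a b c : R) (f g h u v : R -> R) (U V : nat -> R -> R).

Lemma ae_imp (P Q : R -> Prop) : (forall x, P x -> Q x) ->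
  {ae mu, forall x, P x} -> {ae mu, forall x, Q x}.
Proof. by move=> PQ; apply: filterS => //; exact: (ae_filter_ringOfSetsType mu). Qed.

Lemma ae_imp2 (P Q S : R -> Prop) : (forall x, P x -> Q x -> S x) ->
  {ae mu, forall x, P x} -> {ae mu, forall x, Q x} -> {ae mu, forall x, S x}.
Proof. by move=> PQ; apply: filterS2 => //; exact: (ae_filter_ringOfSetsType mu). Qed.

Lemma integrable_itv g (i : interval R) : mu.-integrable setT (EFin \o g) ->
  mu.-integrable [set` i] (EFin \o g).
Proof. by apply: integrableS => //; exact: measurable_itv. Qed.

Lemma Rintegral_primitiveB g x y : mu.-integrable setT (EFin \o g) -> x <= y ->
  \int[mu]_(z in `]-oo, y]) g z - \int[mu]_(z in `]-oo, x]) g z =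
  \int[mu]_(z in `]x, y]) g z.
Proof. by move=> ig xy; apply: Rintegral_itvB => //; exact: integrable_itv. Qed.

(** Absolute continuity of the integral as a set function, applied to the union of the disjoint
    intervals []s i, t i]], whose measure is the sum of the lengths. *)
Lemma ac_primitive a b g : mu.-integrable setT (EFin \o g) ->
  ac a b (fun x => \int[mu]_(y in `]-oo, x]) g y).
Proof.
move=> ig e /(integral_normr_continuous ig)[d [d0 H]].
exists d => // m s t st dj std.
have ign := integrable_norm ig.
pose F (i : 'I_m) : set R := `]s i, t i]%classic.
have mF i : measurable (F i) by exact: measurable_itv.
have tF : trivIset [set` index_enum 'I_m] F.
  move=> i j _ _ [x [/=]]; rewrite /F/= !in_itv/= => /andP[si ti] /andP[sj tj].
  apply/eqP; apply: contraT => ij; have [] := dj _ _ ij.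
  - by move=> /(le_trans ti)/(lt_le_trans sj); rewrite ltxx.
  - by move=> /(le_trans tj)/(lt_le_trans si); rewrite ltxx.
have uF := index_enum_uniq 'I_m.
have mD : measurable (\big[setU/set0]_(i < m) F i) by exact: bigsetU_measurable.
(* Measures are written as integrals of 1, so that one additivity result over disjoint unions serves
   for the lengths here and for [g] below. *)
have mu1 (A : set R) : measurable A -> (\int[mu]_(x in A) 1%:E)%E = mu A.
  by move=> mA; rewrite integral_cst//; exact: mul1e.
have muD : (mu (\big[setU/set0]_(i < m) F i) < d%:E)%E.
  rewrite -(mu1 _ mD) (@integral_bigsetU_EFin _ _ _ mu _ F (fun=> 1))//;
    last exact: measurable_cst.
  rewrite (eq_bigr (fun i => (t i - s i)%:E)); last first.
    move=> i _; rewrite mu1// lebesgue_measure_itv/= lte_fin.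
    have [_ [sti _]] := st i; case: ltP => // tsi.
    by congr EFin; lra.
  by rewrite sumEFin lte_fin.
have := H _ mD muD; apply: le_lt_trans.
have -> : \int[mu]_(x in \big[setU/set0]_(i < m) F i) `|g x| =
    \sum_(i < m) \int[mu]_(x in F i) `|g x|.
  rewrite /Rintegral.
  rewrite (@integral_bigsetU_EFin _ _ _ mu _ F (fun x => `|g x|))//.
    rewrite -sum_fine//; last first.
      move=> i _; apply: integrable_fin_num; first exact: mF.
      exact: (@integrable_itv _ `]s i, t i] ign).
  apply: measurable_funTS; exact: measurable_int ign.
apply: ler_sum => i _; have [_ [sti _]] := st i.
rewrite Rintegral_primitiveB//; apply: le_normr_Rintegral => //.
exact: integrable_itv.
Qed.

(** With [G] a primitive of [h], Lebesgue differentiation gives [G - f] an a.e. nonnegative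
    derivative on the interval, so [G - f] does not decrease from [a] to [b]. *)
Lemma ac_derive_le_integral a b f h : a <= b -> ac a b f ->
  mu.-integrable `]a, b] (EFin \o h) ->
  {ae mu, forall x, a < x < b -> exists2 d, is_derive x (1 : R) f d & d <= h x} ->
  f b - f a <= \int[mu]_(x in `]a, b]) h x.
Proof.
(* Extending [h] by zero makes it integrable on the whole line, where the primitive from minus
   infinity is defined. *)
move=> ab acf ih df; pose g := h \_ `]a, b].
have ig : mu.-integrable setT (EFin \o g).
  rewrite /g -restrict_EFin; apply/integrable_restrict => //.
  by rewrite setTI.
have lg : locally_integrable setT g by exact: integrable_locally.
pose G x := \int[mu]_(y in `]-oo, x]) g y.
have dG : {ae mu, forall x, derivable G x 1 /\ derive1 G x = g x}.
  by apply: FTC1Ny => // y; exact: integrable_itv.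
have le_ab : G a - f a <= G b - f b.
  apply: (ac_derive_ge0 (f := fun x => G x - f x)) => //.
    by apply: acB => //; exact: ac_primitive.
  move: df dG; apply: ae_imp2 => x df [dG G'] /[dup] axb /df[d fd dh].
  have GD : is_derive x (1 : R) G (g x).
    by split => //; rewrite -derive1E.
  exists (g x - d); first exact: is_deriveB.
  rewrite subr_ge0 /g patchE mem_set//=.
  by rewrite in_itv/=; move: axb => /andP[-> /ltW].
have -> : \int[mu]_(x in `]a, b]) h x = G b - G a.
  rewrite /G Rintegral_primitiveB//; apply: eq_Rintegral => x xab.
  by rewrite /g patchE xab.
lra.
Qed.

End Integrals.

(** * Extension to the left endpoint *)

Section Extension.
Set Implicit Arguments.
Unset Strict Implicit.
Variable R : realType.
Notation mu := (@lebesgue_measure R).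
Implicit Types (a b c : R) (f g h u v : R -> R) (U V : nat -> R -> R).

Lemma ac_dist_le_integral a b f g : a <= b -> ac a b f ->
  mu.-integrable `]a, b] (EFin \o g) ->
  {ae mu, forall x : R, a < x < b -> is_derive x (1 : R) f (g x)} ->
  `|f b - f a| <= \int[mu]_(x in `]a, b]) `|g x|.
Proof.
move=> ab acf ig df; have ign := integrable_norm ig.
rewrite ler_norml; apply/andP; split; last first.
  apply: ac_derive_le_integral => //; apply: ae_imp df => x df axb.
  by exists (g x); [exact: df|exact: ler_norm].
have : - f b - - f a <= \int[mu]_(x in `]a, b]) `|g x|.
  apply: (ac_derive_le_integral (f := fun x => - f x)) => //; first exact: acN.
  apply: ae_imp df => x df axb.
  exists (- g x); first by apply: is_deriveN; exact: df.
  by rewrite -normrN ler_norm.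
lra.
Qed.

(** Increments of [f] are dominated by those of the primitive [G] of [|g|], which is absolutely
    continuous up to 0. Hence [f + G] is monotone and bounded below near 0, which yields the limit,
    and the domination persists at 0. *)
Lemma ac_extend f g :
  (forall a b, 0 < a -> a <= b -> ac a b f) ->
  {ae mu, forall x : R, 0 < x -> is_derive x (1 : R) f (g x)} ->
  (forall c, 0 < c -> mu.-integrable `]0, c] (EFin \o g)) ->
  exists2 l : R, f x @[x --> 0^'+] --> l &
    forall c, ac 0 c (fun x => if x == 0 then l else f x).
Proof.
move=> acf df ig; pose gc c := (fun x => `|g x|) \_ `]0, c].
pose G c x := \int[mu]_(y in `]-oo, x]) gc c y.
have gc0 c x : 0 <= gc c x by rewrite /gc patchE; case: ifP.
have igc c : 0 < c -> mu.-integrable setT (EFin \o gc c).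
  move=> c0; rewrite /gc -restrict_EFin; apply/integrable_restrict => //.
  by rewrite setTI; exact: (integrable_norm (ig _ c0)).
have Gmono c s t : 0 < c -> s <= t -> G c s <= G c t.
  move=> c0 st; rewrite -subr_ge0 /G Rintegral_primitiveB//; last exact: igc.
  by apply: Rintegral_ge0 => x _.
have fG c s t : 0 < s -> s <= t -> t <= c -> `|f t - f s| <= G c t - G c s.
  move=> s0 st tc.
  have c0 : 0 < c by rewrite (lt_le_trans s0)// (le_trans st).
  rewrite /G Rintegral_primitiveB//; last exact: igc.
  have -> : \int[mu]_(z in `]s, t]) gc c z = \int[mu]_(z in `]s, t]) `|g z|.
    apply: eq_Rintegral => x; rewrite inE/= in_itv/= => /andP[sx xt].
    by rewrite /gc patchE mem_set//= in_itv/= (lt_trans s0)// (le_trans xt).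
  apply: ac_dist_le_integral => //; first exact: acf.
    apply: integrableS (ig c c0) => //.
    by apply: subset_itv; rewrite bnd_simp// ltW.
  by apply: ae_imp df => x dfx /andP[sx _]; apply: dfx; exact: lt_trans sx.
have acG a b c : 0 < c -> ac a b (G c) by move=> c0; apply: ac_primitive; exact: igc.
have [l fl] : exists l : R, f x @[x --> 0^'+] --> l.
  have Gcv : G 1 x @[x --> 0^'+] --> G 1 0.
    apply: cvg_at_right_filter.
    exact: (ac_continuous_at (acG (- 1) 1 1 ltr01)).
  have kcv : f x + G 1 x @[x --> 0^'+] -->
      inf [set f x + G 1 x | x in `]0, 1]].
    apply: nondecreasing_at_right_cvgr.
    - by rewrite bnd_simp.
    - move=> x y; rewrite !in_itv/= => /andP[x0 x1] /andP[y0 y1] xy.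
      by have := fG _ _ _ x0 xy y1; rewrite ler_norml => /andP[+ _]; lra.
    - exists (f 1 - G 1 1) => z /= [x + <-]; rewrite in_itv/= => /andP[x0 x1].
      have := fG _ _ _ x0 x1 (lexx _); rewrite ler_norml => /andP[_].
      have : 0 <= G 1 x by apply: Rintegral_ge0.
      lra.
  move: (inf _) kcv => L kcv; exists (L - G 1 0).
  have -> : f = (fun x => f x + G 1 x - G 1 x) by apply/funext => x; rewrite addrK.
  exact: cvgB.
exists l => // c; have [/ac_degenerate//|c0] := leP c 0.
(* The domination at the endpoint 0, obtained by letting [s] decrease to 0 in [fG]. *)
have lG t : 0 < t -> t <= c -> `|f t - l| <= G c t - G c 0.
  move=> t0 tc; apply/ler_addgt0Pr => e e0.
  near (0 : R)^'+ => s.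
  have s0 : 0 < s by near: s; exact: nbhs_right_gt.
  have st : s <= t by near: s; exact: nbhs_right_le.
  have ls : `|l - f s| < e by near: s; move/cvgrPdist_lt : fl; apply.
  have := fG _ _ _ s0 st tc; have := Gmono _ _ _ c0 (ltW s0).
  have := ler_distD (f s) (f t) l; rewrite (distrC (f s) l).
  lra.
apply: (@ac_dom _ _ _ (G c) (G c) _ 1); [exact: acG|exact: acG|].
move=> x y x0 xy yc; rewrite mul1r.
have W : forall A B : R, A <= B -> A <= `|B| + `|B|.
  by move=> A B AB; have := ler_norm B; have := normr_ge0 B; lra.
apply: W; have [y0|yn0] := eqVneq y 0.
  have -> : x = 0 by apply/eqP; rewrite eq_le x0 -y0 xy.
  by rewrite eqxx subrr normr0 y0 subrr.
have y0 : 0 < y by rewrite lt_neqAle eq_sym yn0 (le_trans x0).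
have [->|xn0] := eqVneq x 0; first exact: lG.
by apply: fG => //; rewrite lt_neqAle eq_sym xn0.
Unshelve. all: by end_near. Qed.

End Extension.

(** * Hardy inequality *)

Section Hardy.
Set Implicit Arguments.
Unset Strict Implicit.
Variable R : realType.
Notation mu := (@lebesgue_measure R).
Implicit Types (a b c : R) (f g h u v : R -> R) (U V : nat -> R -> R).

(** Real-valued counterpart of [L2pos]. *)
Definition sqint f := measurable_fun (@Ipos R) f /\
  mu.-integrable (@Ipos R) (fun x => (f x ^+ 2)%:E).

Lemma measurable_Ipos : measurable (@Ipos R).
Proof. exact: measurable_itv. Qed.

Lemma ac_measurable_Ipos f : (forall a b, 0 < a -> a <= b -> ac a b f) ->
  measurable_fun (@Ipos R) f.
Proof.
move=> acf; apply: open_continuous_measurable_fun; first exact: interval_open.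
move=> x; rewrite inE /Ipos/= in_itv/= andbT => x0.
by apply: (@ac_continuous_at _ (x / 2) (x * 2)); [apply: acf|..]; lra.
Qed.

Lemma Rintegral_Ipos_ge (A : set R) h : measurable A -> A `<=` @Ipos R ->
  mu.-integrable (@Ipos R) (EFin \o h) -> (forall x, 0 <= h x) ->
  \int[mu]_(x in A) h x <= \int[mu]_(x in @Ipos R) h x.
Proof.
move=> mA AI ih h0; have mI := measurable_Ipos.
have iA : mu.-integrable A (EFin \o h) by apply: integrableS ih.
apply: fine_le.
- by apply: integrable_fin_num iA.
- by apply: integrable_fin_num ih.
- apply: ge0_subset_integral => //; first exact: measurable_int ih.
  by move=> x _; rewrite lee_fin.
Qed.

(** Since [f 0 = 0], [|f x|] is at most the integral of [|g|] over []0, x]]. A weighted AM-GM bound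
    replaces Cauchy-Schwarz; only the power of [x] matters later, not the constant. *)
Lemma Hardy_pointwise f g k x : ac 0 x f -> f 0 = 0 ->
  {ae mu, forall x : R, 0 < x -> is_derive x (1 : R) f (g x)} ->
  sqint (fun x => g x / x ^+ k) -> 0 < x ->
  f x ^+ 2 <= x ^+ (2 * k).+1 *
    ((\int[mu]_(y in @Ipos R) (g y / y ^+ k) ^+ 2 + 1) ^+ 2 / 4).
Proof.
move=> acf f0 df [mq iq] x0; set A := Rintegral _ _ _.
(* [r] is [x] to the power [k + 1/2], the weight that makes both terms of the integrated majorant
   multiples of [r]. *)
pose r := Num.sqrt (x ^+ (2 * k).+1).
have r2 : r ^+ 2 = x ^+ (2 * k).+1 by rewrite sqr_sqrtr// exprn_ge0// ltW.
have r0 : 0 < r by rewrite sqrtr_gt0 exprn_gt0.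
pose q y := g y / y ^+ k.
have A0 : 0 <= A by apply: Rintegral_ge0 => y _; exact: sqr_ge0.
have sub : `]0, x] `<=` @Ipos R by apply: subset_itvl.
have iqx : mu.-integrable `]0, x] (EFin \o (fun y => q y ^+ 2)).
  by apply: integrableS iq => //; exact: measurable_Ipos.
have icst c : mu.-integrable `]0, x] (EFin \o (fun=> c)).
  exact/ac_integrable/ac_cst.
(* AM-GM: |g| = |q| y^k <= r q^2 / 2 + x^(2k) / (2 r) on ]0, x]. *)
pose h y := r / 2 * q y ^+ 2 + x ^+ (2 * k) / (2 * r).
have iqx' : mu.-integrable `]0, x] (EFin \o (fun y => r / 2 * q y ^+ 2)).
  by have := integrableZl _ (r / 2) iqx; apply.
have ih : mu.-integrable `]0, x] (EFin \o h).
  by have := integrableD _ iqx' (icst (x ^+ (2 * k) / (2 * r))); apply.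
have hle : \int[mu]_(y in `]0, x]) h y <= r * (A + 1) / 2.
  have intc c : \int[mu]_(y in `]0, x]) c = c * x.
    transitivity (c * fine (mu `]0, x])); first exact: Rintegral_cst.
    by rewrite lebesgue_measure_itv/= lte_fin x0/= subr0.
  rewrite RintegralD// intc RintegralZl//.
  have -> : x ^+ (2 * k) / (2 * r) * x = r / 2.
    have -> : x ^+ (2 * k) / (2 * r) * x = x ^+ (2 * k).+1 / (2 * r).
      by rewrite exprSr; ring.
    by rewrite -r2; field; rewrite gt_eqF.
  have -> : r * (A + 1) / 2 = r / 2 * A + r / 2 by field.
  rewrite lerD2r ler_wpM2l ?divr_ge0 ?(ltW r0)//.
  by apply: Rintegral_Ipos_ge => // y; exact: sqr_ge0.
have gh y : 0 < y < x -> `|g y| <= h y.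
  move=> /andP[y0 yx].
  have yk : 0 < y ^+ k by rewrite exprn_gt0.
  have yxk : y ^+ k <= x ^+ k by rewrite lerXn2r ?nnegrE ?(ltW y0) ?(ltW x0) ?(ltW yx).
  have -> : g y = q y * y ^+ k by rewrite /q; field; rewrite gt_eqF.
  rewrite normrM (gtr0_norm yk).
  apply: (@le_trans _ _ (`|q y| * x ^+ k)); first by rewrite ler_wpM2l.
  have -> : h y = (r ^+ 2 * `|q y| ^+ 2 + (x ^+ k) ^+ 2) / (2 * r).
    by rewrite /h real_normK ?num_real// mulnC exprM; field; rewrite gt_eqF.
  rewrite ler_pdivlMr ?mulr_gt0//.
  have := sqr_ge0 (r * `|q y| - x ^+ k); nra.
(* Stated for a general pair in order to serve both [f] and [- f]. *)
have bnd F G : ac 0 x F -> F 0 = 0 -> (forall y, `|G y| = `|g y|) ->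
    {ae mu, forall y : R, 0 < y -> is_derive y (1 : R) F (G y)} ->
    F x <= r * (A + 1) / 2.
  move=> acF F0 Gg dF; apply: le_trans hle.
  have := @ac_derive_le_integral _ 0 x F h (ltW x0) acF ih.
  rewrite F0 subr0; apply; apply: ae_imp dF => y dF /andP[y0 yx].
  exists (G y); first exact: dF.
  by rewrite (le_trans (ler_norm _))// Gg gh// y0.
have fx : `|f x| <= r * (A + 1) / 2.
  rewrite ler_norml lerNl; apply/andP; split; last exact: bnd df.
  apply: (bnd (fun y => - f y) (fun y => - g y)); rewrite ?f0 ?oppr0//.
  - exact: acN.
  - by move=> y; rewrite normrN.
  - by apply: ae_imp df => y df y0; apply: is_deriveN; exact: df.
have -> : x ^+ (2 * k).+1 * ((A + 1) ^+ 2 / 4) = (r * (A + 1) / 2) ^+ 2.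
  by rewrite -r2; field.
by rewrite -[f x ^+ 2]real_normK ?num_real// lerXn2r ?nnegrE// (le_trans _ fx).
Qed.

(** With [p = f / x^(k+1)] and [q = g / x^k] this is the derivative of [x p^2]. The term in [p^2]
    has a negative coefficient, which is what lets the integral of [p^2] be bounded. *)
Lemma is_derive_Hardy f (x gx : R) k : 0 < x -> is_derive x (1 : R) f gx ->
  is_derive x (1 : R) (fun y => y * (f y * y^-1 ^+ k.+1) ^+ 2)
    (2 * (f x * x^-1 ^+ k.+1) * (gx / x ^+ k)
     - (2 * k%:R + 1) * (f x * x^-1 ^+ k.+1) ^+ 2).
Proof.
move=> x0 df; have xn0 : x != 0 by rewrite gt_eqF.
have dV : is_derive x (1 : R) (fun y : R => y^-1) (- x ^- 2).
  by apply: is_derive_eq; [exact: (is_deriveV (f := id))|rewrite [LHS]mulr1].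
have D := is_deriveM (is_derive_id x (1 : R))
  (is_deriveX 2 (is_deriveM df (is_deriveX k.+1 dV))).
have -> : (fun y => y * (f y * y^-1 ^+ k.+1) ^+ 2) =
    id * (f * (fun y : R => y^-1) ^+ k.+1) ^+ 2.
  by apply/funext => y; rewrite !fctE.
apply: (is_derive_eq D).
rewrite /GRing.scale/= !fctE /= -!exprVn [x^-1 ^+ k.+1]exprS.
set z := x^-1 ^+ k; rewrite -[k.+1%:R]natr1.
by field.
Qed.

(** The derivative of [x p^2] is at most [2 q^2 - p^2 / 2]. Integrated over []a, b]], it bounds the
    integral of [p^2] independently of [a] and [b]: the boundary term at [b] has a good sign, and
    the one at [a] is bounded by the pointwise estimate. Monotone convergence concludes. *)
Lemma Hardy f g k : (forall c, ac 0 c f) -> f 0 = 0 ->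
  {ae mu, forall x : R, 0 < x -> is_derive x (1 : R) f (g x)} ->
  sqint (fun x => g x / x ^+ k) -> sqint (fun x => f x / x ^+ k.+1).
Proof.
move=> acf f0 df sq; have [mq iq] := sq.
pose p x := f x * x^-1 ^+ k.+1; pose q x := g x / x ^+ k.
have -> : (fun x => f x / x ^+ k.+1) = p.
  by apply/funext => x; rewrite /p exprVn.
set A := \int[mu]_(y in @Ipos R) (q y) ^+ 2.
(* Twice the sum of the boundary bound [(A + 1)^2 / 4] and of [2 A]. *)
pose B := (A + 1) ^+ 2 / 2 + 4 * A.
have acp a b : 0 < a -> a <= b -> ac a b p.
  move=> a0 ab; apply: acM; first by apply: ac_sub (acf b) => //; exact: ltW.
  exact/acX/ac_inv.
have mp : measurable_fun (@Ipos R) p by exact: ac_measurable_Ipos.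
split => //.
have pB a b : 0 < a -> a <= b -> \int[mu]_(x in `]a, b]) p x ^+ 2 <= B.
  move=> a0 ab; have b0 : 0 < b := lt_le_trans a0 ab.
  have sub : `]a, b] `<=` @Ipos R by apply: subset_itv; rewrite bnd_simp// ltW.
  have ip : mu.-integrable `]a, b] (EFin \o (fun x => p x ^+ 2)).
    exact/ac_integrable/acX/acp.
  have iqab : mu.-integrable `]a, b] (EFin \o (fun y => q y ^+ 2)).
    by apply: integrableS iq => //; exact: measurable_Ipos.
  have ip2 : mu.-integrable `]a, b] (EFin \o (fun x => 2^-1 * p x ^+ 2)).
    by have := integrableZl _ 2^-1 ip; apply.
  have iq2 : mu.-integrable `]a, b] (EFin \o (fun x => 2 * q x ^+ 2)).
    by have := integrableZl _ 2 iqab; apply.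
  (* x p^2 has derivative 2 p q - (2 k + 1) p^2 <= h. *)
  pose h x := 2 * q x ^+ 2 - 2^-1 * p x ^+ 2.
  have ih : mu.-integrable `]a, b] (EFin \o h).
    by have := integrableB _ iq2 ip2; apply.
  have qA : \int[mu]_(x in `]a, b]) q x ^+ 2 <= A.
    by apply: Rintegral_Ipos_ge => // y; exact: sqr_ge0.
  pose Phi y := y * p y ^+ 2.
  have : Phi b - Phi a <= \int[mu]_(x in `]a, b]) h x.
    apply: ac_derive_le_integral => //.
      by apply: acM; [exact: ac_id|exact/acX/acp].
    apply: ae_imp df => x dfx /andP[ax xb]; have x0 : 0 < x := lt_trans a0 ax.
    eexists; first exact: (is_derive_Hardy k x0 (dfx x0)).
    rewrite -/(p x) -/(q x) /h.
    have := sqr_ge0 (p x - 2 * q x); have := sqr_ge0 (p x).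
    have : 0 <= k%:R :> R by [].
    nra.
  rewrite RintegralB// !RintegralZl//.
  have : 0 <= Phi b by rewrite mulr_ge0 ?sqr_ge0// ltW.
  have : Phi a <= (A + 1) ^+ 2 / 4.
    have := Hardy_pointwise (acf a) f0 df sq a0; rewrite -/q -/A.
    have -> : Phi a = f a ^+ 2 / a ^+ (2 * k).+1.
      rewrite /Phi /p exprMn -exprM exprVn.
      rewrite (_ : (k.+1 * 2 = (2 * k).+2)%N); last by rewrite mulnC mulnS.
      by rewrite [a ^+ (2 * k).+2]exprS; field; rewrite ?expf_neq0 ?gt_eqF.
    by rewrite ler_pdivrMr ?exprn_gt0// mulrC.
  by rewrite /B; lra.
pose F (m : nat) : set R := `]m.+1%:R^-1, m.+1%:R]%classic.
have F_Ipos : \bigcup_m F m = @Ipos R.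
  apply/seteqP; split => [x [m _]|x]; rewrite /F /Ipos/= !in_itv/= andbT.
    by move=> /andP[+ _]; apply: lt_trans; rewrite invr_gt0.
  (* This index makes [m + 1] exceed both [x] and [1 / x]. *)
  move=> x0; exists (Num.truncn (x + x^-1)) => //=; rewrite in_itv/=.
  have := truncnS_gt (x + x^-1); have xi : 0 < x^-1 by rewrite invr_gt0.
  move=> xN; apply/andP; split.
    by rewrite invf_plt ?posrE// (le_lt_trans _ xN)// lerDr ltW.
  by rewrite ltW// (le_lt_trans _ xN)// lerDl ltW.
have mF m : measurable (F m) by exact: measurable_itv.
have subF m : F m `<=` @Ipos R by rewrite -F_Ipos; exact: bigcup_sup.
have ip0 : (\int[mu]_(x in @Ipos R) (p x ^+ 2)%:E <= B%:E)%E.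
  have H : (\int[mu]_(x in F m) (p x ^+ 2)%:E)%E @[m --> \oo] -->
      (\int[mu]_(x in @Ipos R) (p x ^+ 2)%:E)%E.
    rewrite -F_Ipos; apply: ge0_nondecreasing_set_cvg_integral => //.
    - move=> i j ij; apply/subsetPset; apply: subset_itv; rewrite bnd_simp.
        by rewrite lef_pV2 ?posrE// ler_nat.
      by rewrite ler_nat.
    - move=> i; apply/measurable_EFinP; apply: measurable_funX.
      by apply: measurable_funS mp => //; exact: measurable_Ipos.
    - by move=> i x _; rewrite lee_fin sqr_ge0.
  rewrite -(cvg_lim _ H)//; apply: lime_le; first by apply/cvg_ex; eexists; exact: H.
  near=> m.
  have m0 : 0 < m.+1%:R^-1 :> R by rewrite invr_gt0.
  have m1 : m.+1%:R^-1 <= m.+1%:R :> R.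
    by apply: (@le_trans _ _ 1); rewrite ?ler1n// invf_le1// ler1n.
  rewrite -[leLHS]fineK; first by rewrite lee_fin; exact: pB.
  have iF := ac_integrable (acX 2 (acp _ _ m0 m1)).
  by apply: integrable_fin_num iF.
apply/integrableP; split.
  by apply/measurable_EFinP; exact: measurable_funX.
under eq_integral do rewrite gee0_abs ?lee_fin ?sqr_ge0//.
by apply: le_lt_trans ip0 _; exact: ltry.
Unshelve. all: by end_near. Qed.

End Hardy.

(** * Initial values *)

Section Vanishing.
Set Implicit Arguments.
Unset Strict Implicit.
Variable R : realType.
Notation mu := (@lebesgue_measure R).
Implicit Types (a b c : R) (f g h u v : R -> R) (U V : nat -> R -> R).

Lemma Ipos_gt0 (x : R) : Ipos x <-> 0 < x.
Proof. by rewrite /Ipos/= in_itv/= andbT. Qed.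

Lemma sqint_eq f g : (forall x, 0 < x -> f x = g x) -> sqint f -> sqint g.
Proof.
move=> fg [mf if2]; split.
  by apply: eq_measurable_fun mf => x; rewrite inE => /Ipos_gt0; exact: fg.
apply: eq_integrable if2; first exact: measurable_Ipos.
by move=> x; rewrite inE => /Ipos_gt0/fg ->.
Qed.

Lemma L2posP u v : L2pos u v <-> sqint u /\ sqint v.
Proof.
have mI := @measurable_Ipos R; split.
  move=> [mu_ mv iuv]; split; split => //; apply: le_integrable iuv => //.
  - by apply/measurable_EFinP; exact: measurable_funX.
  - move=> x _; rewrite !gee0_abs ?lee_fin ?addr_ge0 ?sqr_ge0//.
    by rewrite lerDl sqr_ge0.
  - by apply/measurable_EFinP; exact: measurable_funX.
  - move=> x _; rewrite !gee0_abs ?lee_fin ?addr_ge0 ?sqr_ge0//.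
    by rewrite lerDr sqr_ge0.
move=> [[mu_ iu] [mv iv]]; split => //.
by have := integrableD _ iu iv; apply; exact: mI.
Qed.

(** On a bounded interval [1 + g^2] is an integrable majorant of [|g|]. *)
Lemma sqint_integrable c g : sqint g -> mu.-integrable `]0, c] (EFin \o g).
Proof.
move=> [mg ig]; have sub : `]0, c] `<=` @Ipos R by apply: subset_itvl.
have mI := @measurable_Ipos R.
have i1 : mu.-integrable `]0, c] (EFin \o (fun=> 1 : R)).
  exact/ac_integrable/ac_cst.
have i2 : mu.-integrable `]0, c] (fun x => (g x ^+ 2)%:E).
  by apply: integrableS ig.
have i3 : mu.-integrable `]0, c] (fun x => (1 + g x ^+ 2)%:E).
  by have := integrableD _ i1 i2; apply.
apply: le_integrable i3 => //.
  by apply/measurable_EFinP; apply: measurable_funS mg.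
move=> x _ /=; rewrite lee_fin [leRHS]ger0_norm ?addr_ge0 ?sqr_ge0//.
rewrite -real_normK ?num_real//.
by have := sqr_ge0 (`|g x| - 1); have := normr_ge0 (g x); nra.
Qed.

(** On []t, 2 t]] the square of [h] is at least [c^2 / (4 t^2)], so its integral there is at least
    [c^2 / (4 t)], which is unbounded as [t] tends to 0. *)
Lemma not_sqint_inv a c h : 0 < a -> 0 < c ->
  (forall x, 0 < x < a -> c / x <= h x) -> ~ sqint h.
Proof.
move=> a0 c0 hc [mh ih]; set A := \int[mu]_(x in @Ipos R) (h x ^+ 2).
have A0 : 0 <= A by apply: Rintegral_ge0 => x _; exact: sqr_ge0.
(* The first bound keeps []t, 2 t]] below [a]; the second makes [c^2 / (4 t)] at least [A + 1]. *)
pose t := Num.min (a / 4) (c ^+ 2 / (4 * (A + 1))).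
have t0 : 0 < t by rewrite lt_min !divr_gt0 ?exprn_gt0// mulr_gt0//; lra.
have t2 : t < 2 * t by rewrite ltr_pMl// ltr1n.
have ta : t <= a / 4 by rewrite ge_min lexx.
have tA : t <= c ^+ 2 / (4 * (A + 1)) by rewrite ge_min lexx orbT.
have A1 : 0 < 4 * (A + 1) by lra.
have H4 : A + 1 <= c ^+ 2 / (4 * t).
  by rewrite ler_pdivlMr ?mulr_gt0//; move: tA; rewrite ler_pdivlMr//; lra.
have sub : `]t, 2 * t] `<=` @Ipos R by apply: subset_itv; rewrite bnd_simp// ltW.
have H1 : \int[mu]_(x in `]t, 2 * t]) (h x ^+ 2) <= A.
  by apply: Rintegral_Ipos_ge => // x; exact: sqr_ge0.
have H2 : \int[mu]_(x in `]t, 2 * t]) ((c / (2 * t)) ^+ 2) <=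
    \int[mu]_(x in `]t, 2 * t]) (h x ^+ 2).
  apply: le_Rintegral => //.
  - exact/ac_integrable/ac_cst.
  - by apply: integrableS ih => //; exact: measurable_Ipos.
  - move=> x /=; rewrite in_itv/= => /andP[tx xt].
    have x0 : 0 < x := lt_trans t0 tx.
    have cx : c / (2 * t) <= c / x by rewrite ler_pM2l// lef_pV2 ?posrE// mulr_gt0.
    have xa : x < a by lra.
    have c2 : 0 <= c / (2 * t) by rewrite divr_ge0// ?mulr_ge0// ltW.
    have := hc x; rewrite x0 xa => /(_ isT) chx.
    by rewrite lerXn2r ?nnegrE// ?(le_trans cx)// (le_trans c2)// (le_trans cx).
have H3 : \int[mu]_(x in `]t, 2 * t]) ((c / (2 * t)) ^+ 2) = c ^+ 2 / (4 * t).
  transitivity ((c / (2 * t)) ^+ 2 * fine (mu `]t, 2 * t])); first exact: Rintegral_cst.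
  rewrite lebesgue_measure_itv/= lte_fin t2.
  by rewrite /=; field; rewrite gt_eqF.
rewrite -H3 in H4; have := le_trans (le_trans H4 H2) H1.
by rewrite gerDl ler10.
Qed.

(** One integration of a lower bound by a power: [f - c x^(m+1) / (m+1)] vanishes at 0 and has an
    a.e. nonnegative derivative. *)
Lemma ac_ge_pow f g a c m : ac 0 a f -> f 0 = 0 ->
  {ae mu, forall x : R, 0 < x -> is_derive x (1 : R) f (g x)} ->
  (forall x, 0 < x < a -> c * x ^+ m <= g x) ->
  forall x, 0 <= x -> x <= a -> c / m.+1%:R * x ^+ m.+1 <= f x.
Proof.
move=> acf f0 df gc x x0 xa.
pose k y := f y - c / m.+1%:R * y ^+ m.+1.
suff : k 0 <= k x by rewrite /k f0 expr0n/= mulr0 subrr subr_ge0.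
apply: ac_derive_ge0 => //.
  apply: acB; first exact: ac_sub acf.
  by apply: acM; [exact: ac_cst|exact/acX/ac_id].
apply: ae_imp df => y df /andP[y0 yx].
exists (g y - c * y ^+ m); last first.
  by rewrite subr_ge0 gc// y0 (lt_le_trans yx).
have D := is_deriveB (df y0) (is_deriveZ (c / m.+1%:R)
  (is_deriveX m.+1 (is_derive_id y (1 : R)))).
have -> : k = f - (c / m.+1%:R) *: (id : R -> R) ^+ m.+1.
  by apply/funext => z; rewrite !fctE.
apply: (is_derive_eq D); rewrite /GRing.scale/=.
by rewrite mulr1 mulrA divfK ?pnatr_eq0.
Qed.

(** If [U j 0 > 0], then [U j] stays above half that value near 0, and [j] integrations give
    [U 0 >= c x^j]; dividing by [x^n] contradicts square integrability. The other sign follows by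
    passing to [- U]. *)
Lemma initial_value_le0 U n j : (forall i, (i < n)%N -> forall c, ac 0 c (U i)) ->
  (forall i, (i < n)%N ->
    {ae mu, forall x : R, 0 < x -> is_derive x (1 : R) (U i) (U i.+1 x)}) ->
  sqint (fun x => U 0%N x / x ^+ n) -> (j < n)%N ->
  (forall i, (i < j)%N -> U i 0 = 0) -> U j 0 <= 0.
Proof.
move=> acU dU sU jn U0; rewrite leNgt; apply/negP => Uj0.
have e0 : 0 < U j 0 / 2 by rewrite divr_gt0.
have [d d0 H] := ac_unif_cont (acU _ jn 1) e0.
(* [d / 2] gives the strict bound [x < d] up to [x = a]; the cap 1 makes powers of [x] at most 1 at
   the end. *)
pose a := Num.min (d / 2) 1.
have a0 : 0 < a by rewrite lt_min divr_gt0/=.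
have a1 : a <= 1 by rewrite ge_min lexx orbT.
have ad : a <= d / 2 by rewrite ge_min lexx.
(* Here [i] counts the integrations, descending from [U j] to [U 0]. *)
have low i : (i <= j)%N -> exists2 c, 0 < c &
    forall x, 0 <= x -> x <= a -> c * x ^+ i <= U (j - i)%N x.
  elim: i => [|i IH] ij.
    exists (U j 0 / 2) => // x x0 xa; rewrite subn0 expr0 mulr1.
    have := H 0 x; rewrite subr0 (ger0_norm x0) => /(_ _ _ _ _ _).
    rewrite ltr_norml => Hx.
    have /andP[+ _] : - (U j 0 / 2) < U j x - U j 0 < U j 0 / 2.
      by apply: Hx => //; lra.
    by lra.
  have [c c0 Hc] := IH (ltnW ij).
  have jin : (j - i.+1 < n)%N by rewrite (leq_ltn_trans (leq_subr _ _)).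
  exists (c / i.+1%:R); first by rewrite divr_gt0.
  have Sji : (j - i.+1).+1 = (j - i)%N by rewrite subnSK.
  apply: (ac_ge_pow (g := U (j - i)%N)).
  - exact: acU.
  - by apply: U0; rewrite ltn_subrL (leq_ltn_trans _ ij).
  - by rewrite -Sji; exact: dU.
  - by move=> x /andP[x0 xa]; apply: Hc; exact: ltW.
have [c c0 Hc] := low j (leqnn j).
apply: (not_sqint_inv a0 c0 _ sU) => x /andP[x0 xa].
have := Hc _ (ltW x0) (ltW xa); rewrite subnn => cU.
have xn : 0 < x ^+ n by rewrite exprn_gt0.
rewrite ler_pdivlMr//; apply: le_trans cU.
(* As [j < n], [x^n / x] is [x^(n-j-1) x^j], and the first factor is at most 1. *)
rewrite -mulrA ler_pM2l// -(subnK jn) exprD exprS mulrCA mulKf ?gt_eqF//.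
apply: ler_piMl; first by rewrite exprn_ge0// ltW.
by apply: exprn_ile1; [exact: ltW|exact: le_trans (ltW xa) a1].
Qed.

Lemma initial_value_eq0 U n : (forall i, (i < n)%N -> forall c, ac 0 c (U i)) ->
  (forall i, (i < n)%N ->
    {ae mu, forall x : R, 0 < x -> is_derive x (1 : R) (U i) (U i.+1 x)}) ->
  sqint (fun x => U 0%N x / x ^+ n) -> forall j, (j < n)%N -> U j 0 = 0.
Proof.
move=> acU dU sU j; have [m] := ubnP j; elim: m j => // m IH j jm jn.
have U0 i : (i < j)%N -> U i 0 = 0.
  by move=> ij; apply: IH; [exact: (leq_trans ij)|exact: ltn_trans jn].
apply/eqP; rewrite eq_le (initial_value_le0 acU dU sU jn U0)/= -oppr_le0.
apply: (@initial_value_le0 (fun i x => - U i x) n) => //.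
- by move=> i ni c; apply/acN/acU.
- move=> i ni; apply: ae_imp (dU _ ni) => x dUx x0.
  by apply: is_deriveN; exact: dUx.
- have [mU iU] := sU; split.
    have -> : (fun x => - U 0%N x / x ^+ n) = (fun x => - (U 0%N x / x ^+ n)).
      by apply/funext => x; rewrite mulNr.
    exact: measurable_funN.
  by under eq_fun do rewrite mulNr sqrrN.
- by move=> i ij; rewrite U0// oppr0.
Qed.

End Vanishing.

(** * The two inclusions *)

Section Inclusions.
Set Implicit Arguments.
Unset Strict Implicit.
Variable R : realType.
Notation mu := (@lebesgue_measure R).
Implicit Types (a b c : R) (f g h u v : R -> R) (U V : nat -> R -> R).

(** Negative arguments keep the values of [f], which are irrelevant. *)
Definition ext0 (l : R) f (x : R) := if x == 0 then l else f x.

Lemma ext0_gt0 l f x : 0 < x -> ext0 l f x = f x.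
Proof. by move=> x0; rewrite /ext0 gt_eqF. Qed.

(** Changing values at 0 affects nothing near [x > 0]; hence [l] and [m] are arbitrary and
    independent. *)
Lemma is_derive_ext0 l m f g (x : R) : 0 < x ->
  is_derive x (1 : R) f (g x) -> is_derive x (1 : R) (ext0 l f) (ext0 m g x).
Proof.
move=> x0 df; rewrite ext0_gt0//; apply: near_eq_is_derive df.
by near=> y; rewrite ext0_gt0//; near: y; exact: lt_nbhsr.
Unshelve. all: by end_near. Qed.

Lemma Hardy_iter U n : (forall j, (j < n)%N -> forall c, ac 0 c (U j)) ->
  (forall j, (j < n)%N -> U j 0 = 0) ->
  (forall j, (j < n)%N ->
    {ae mu, forall x : R, 0 < x -> is_derive x (1 : R) (U j) (U j.+1 x)}) ->
  sqint (U n) -> sqint (fun x => U 0%N x / x ^+ n).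
Proof.
move=> acU U0 dU sU.
suff H i : (i <= n)%N -> sqint (fun x => U (n - i)%N x / x ^+ i).
  by have := H n (leqnn n); rewrite subnn.
elim: i => [_|i IH ni].
  by rewrite subn0; apply: sqint_eq sU => x _; rewrite expr0 divr1.
have nin : (n - i.+1 < n)%N by rewrite ltn_subrL (leq_ltn_trans _ ni).
apply: (Hardy (g := U (n - i)%N)).
- exact: acU.
- exact: U0.
- by rewrite -(subnSK ni); exact: dU.
- exact/IH/ltnW.
Qed.

(** Descending induction from [U n], which is integrable near 0: integrability of [U (j+1)] there
    extends [U j] continuously to 0, which makes [U j] integrable in turn. *)
Lemma extend_derivatives U n :
  (forall j, (j < n)%N -> forall a b, 0 < a -> a <= b -> ac a b (U j)) ->
  (forall j, (j < n)%N ->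
    {ae mu, forall x : R, 0 < x -> is_derive x (1 : R) (U j) (U j.+1 x)}) ->
  sqint (U n) -> exists l : nat -> R, forall j, (j < n)%N ->
    U j x @[x --> 0^'+] --> l j /\ forall c, ac 0 c (ext0 (l j) (U j)).
Proof.
move=> acU dU sU.
have ext j : (j < n)%N -> (forall c, 0 < c -> mu.-integrable `]0, c] (EFin \o U j.+1)) ->
    exists2 l : R, U j x @[x --> 0^'+] --> l & forall c, ac 0 c (ext0 l (U j)).
  by move=> jn ij; exact: (ac_extend (acU _ jn) (dU _ jn)).
have iU i : (i <= n)%N -> forall c, 0 < c ->
    mu.-integrable `]0, c] (EFin \o U (n - i)%N).
  elim: i => [_|i IH ni] c c0; first by rewrite subn0; exact: sqint_integrable.
  have nin : (n - i.+1 < n)%N by rewrite ltn_subrL (leq_ltn_trans _ ni).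
  have [|l _ acl] := ext _ nin; first by rewrite (subnSK ni); exact/IH/ltnW.
  apply: eq_integrable (ac_integrable (acl c)) => // x.
  rewrite inE/= in_itv/= => /andP[x0 _].
  by rewrite ext0_gt0.
(* [lim] is defined for every [j], so no choice depending on a proof of [j < n] is required. *)
exists (fun j => lim (U j x @[x --> 0^'+])) => j jn.
have [|l Ul acl] := ext j jn.
  by move=> c c0; have := iU (n - j.+1)%N (leq_subr _ _) c c0; rewrite subKn.
by rewrite (cvg_lim _ Ul).
Qed.

Lemma initial_values U n :
  (forall j, (j < n)%N -> forall a b, 0 < a -> a <= b -> ac a b (U j)) ->
  (forall j, (j < n)%N ->
    {ae mu, forall x : R, 0 < x -> is_derive x (1 : R) (U j) (U j.+1 x)}) ->
  sqint (U n) -> sqint (fun x => U 0%N x / x ^+ n) -> forall j, (j < n)%N ->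
    U j x @[x --> 0^'+] --> (0 : R) /\ forall c, ac 0 c (ext0 0 (U j)).
Proof.
move=> acU dU sU sU0; have [l lU] := extend_derivatives acU dU sU.
suff l0 j : (j < n)%N -> l j = 0 by move=> j jn; have := lU _ jn; rewrite l0.
move=> jn; have := @initial_value_eq0 _ (fun j => ext0 (l j) (U j)) n.
move=> /(_ _ _ _ j jn); rewrite /ext0 eqxx; apply.
- by move=> i /lU[].
- move=> i /dU; apply: ae_imp => x dUx x0.
  exact: (is_derive_ext0 (l i) (l i.+1) x0 (dUx x0)).
- by apply: sqint_eq sU0 => x x0; rewrite gt_eqF.
Qed.

Lemma ae_derivP u v u' v' : ae_deriv u v u' v' <->
  {ae mu, forall x : R, 0 < x -> is_derive x (1 : R) u (u' x)} /\
  {ae mu, forall x : R, 0 < x -> is_derive x (1 : R) v (v' x)}.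
Proof.
split=> [duv|[du dv]].
  by split; apply: ae_imp duv => x duv /Ipos_gt0/duv[].
by apply: ae_imp2 du dv => x du dv /Ipos_gt0 x0; split; [exact: du|exact: dv].
Qed.

Lemma in_H_hatH n u v : in_H n u v -> in_hatH n u v.
Proof.
move=> [U [V [UV acUV dUV /[dup] sUV /L2posP[sU sV] UV0]]].
exists U, V; split => //.
- by move=> x /ltW; exact: UV.
- move=> j jn a b a0 ab; apply/AC_onP.
  have /AC_onP[acU acV] := acUV _ jn _ (lt_le_trans a0 ab).
  by split; [apply: ac_sub acU|apply: ac_sub acV] => //; exact: ltW.
have acc (W : nat -> R -> R) :
    (forall j, (j < n)%N -> forall c, 0 < c -> ac 0 c (W j)) ->
    forall j, (j < n)%N -> forall c, ac 0 c (W j).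
  by move=> H j jn c; have [/ac_degenerate|/(H _ jn)] := leP c 0.
apply/L2posP; split.
- apply: (@sqint_eq _ (fun x => U 0%N x / x ^+ n)).
    by move=> x /ltW/UV[-> _].
  apply: Hardy_iter => //.
  + by apply: acc => j jn c c0; have /AC_onP[] := acUV _ jn _ c0.
  + by move=> j /UV0[].
  + by move=> j /dUV/ae_derivP[].
- apply: (@sqint_eq _ (fun x => V 0%N x / x ^+ n)).
    by move=> x /ltW/UV[_ ->].
  apply: Hardy_iter => //.
  + by apply: acc => j jn c c0; have /AC_onP[] := acUV _ jn _ c0.
  + by move=> j /UV0[].
  + by move=> j /dUV/ae_derivP[].
Qed.

(** All the limits turn out to be 0, so extending every derivative by 0 gives the witnesses; [U n]
    and [V n] change at most at the origin. *)
Lemma hatH_in_H n u v U V : hatH_wit n u v U V ->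
  (forall j, (j < n)%N ->
    U j x @[x --> 0^'+] --> (0 : R) /\ V j x @[x --> 0^'+] --> (0 : R)) /\
  in_H n (ext0 0 u) (ext0 0 v).
Proof.
move=> [UV acUV dUV /L2posP[sU sV] /L2posP[su sv]].
have HU : forall j, (j < n)%N ->
    U j x @[x --> 0^'+] --> (0 : R) /\ forall c, ac 0 c (ext0 0 (U j)).
  apply: initial_values => //.
  - by move=> j jn a b a0 ab; have /AC_onP[] := acUV _ jn _ _ a0 ab.
  - by move=> j /dUV/ae_derivP[].
  - by apply: sqint_eq su => x /UV[-> _].
have HV : forall j, (j < n)%N ->
    V j x @[x --> 0^'+] --> (0 : R) /\ forall c, ac 0 c (ext0 0 (V j)).
  apply: initial_values => //.
  - by move=> j jn a b a0 ab; have /AC_onP[] := acUV _ jn _ _ a0 ab.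
  - by move=> j /dUV/ae_derivP[].
  - by apply: sqint_eq sv => x /UV[_ ->].
split=> [j jn|]; first by have [? _] := HU _ jn; have [? _] := HV _ jn.
exists (fun j => ext0 0 (U j)), (fun j => ext0 0 (V j)); split.
- move=> x x0; rewrite /ext0; case: eqVneq => // xn0.
  by apply: UV; rewrite lt_neqAle eq_sym xn0.
- move=> j jn c _; apply/AC_onP.
  by have [_ ?] := HU _ jn; have [_ ?] := HV _ jn.
- move=> j /dUV/ae_derivP[dU dV]; apply/ae_derivP; split.
    by apply: ae_imp dU => x dU x0; apply: is_derive_ext0 => //; exact: dU.
  by apply: ae_imp dV => x dV x0; apply: is_derive_ext0 => //; exact: dV.
- apply/L2posP; split.
    by apply: sqint_eq sU => x x0; rewrite ext0_gt0.
  by apply: sqint_eq sV => x x0; rewrite ext0_gt0.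
- by move=> j _; rewrite /ext0 eqxx.
Qed.

End Inclusions.

Theorem theorem3p4 (R : realType) (n : nat) :
  (forall u v : R -> R, in_H n u v -> in_hatH n u v) /\
  (forall (u v : R -> R) (U V : nat -> R -> R), hatH_wit n u v U V ->
     exists lu lv : nat -> R,
       (forall j, (j < n)%N ->
          U j x @[x --> 0^'+] --> lu j /\ V j x @[x --> 0^'+] --> lv j) /\
       in_H n (fun x => if x == 0 then lu 0%N else u x)
              (fun x => if x == 0 then lv 0%N else v x)).
Proof.
split=> [u v|u v U V UV]; first exact: in_H_hatH.
by exists (fun=> 0), (fun=> 0); exact: hatH_in_H UV.
Qed.
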